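(* Let $A\subset \mathbb{H}$ be a closed subset of the Heisenberg group. Assume that $\pi_y(A)$ is nowhere dense in the $xt$-plane $\{(x,0,t): x,t\in\mathbb{R}\}$ and that $\pi_x(A)$ is nowhere dense in the $yt$-plane $\{(0,y,t): y,t\in\mathbb{R}\}$. Then $\mathbb{H}\setminus A$, equipped with the restriction of the Carnot--Carathéodory metric $d_{cc}$, is quasiconvex.
   Context: The Heisenberg group $\mathbb{H}$ is $\mathbb{R}^3$ with the group law $(x,y,t)*(x',y',t') = (x+x',\,y+y',\,t+t'+2(x'y-xy'))$. It carries the left-invariant vector fields $X=\partial_x+2y\,\partial_t$ and $Y=\partial_y-2x\,\partial_t$. An absolutely continuous curve $\gamma$ in $\mathbb{H}$ is horizontal if for almost every $s$ one has $\gamma'(s)=a(s)X+b(s)Y$ (vector fields evaluated at $\gamma(s)$) for some functions $a,b$; its cc-length is $\ell_{cc}(\gamma)=\int\sqrt{a(s)^2+b(s)^2}\,ds$. The Carnot--Carathéodory distance $d_{cc}(p,q)$ is the infimum of the cc-lengths of all horizontal curves joining $p$ to $q$. The topology of $(\mathbb{H},d_{cc})$ is the Euclidean topology of $\mathbb{R}^3$. The projections of $\mathbb{H}$ into the $yt$-plane and the $xt$-plane are $$\pi_x(x,y,t)=(x,y,t)*(-x,0,0)=(0,y,t-2xy),\qquad \pi_y(x,y,t)=(x,y,t)*(0,-y,0)=(x,0,t+2xy).$$ A metric space $(Z,d)$ is $c$-quasiconvex ($c\ge 1$) if every pair of points $u,v\in Z$ can be joined by a rectifiable curve in $Z$ whose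 length is at most $c\,d(u,v)$; it is quasiconvex if it is $c$-quasiconvex for some $c\ge1$. *)

(* Defs.v *)
From HB Require Import structures.
From mathcomp Require Import all_boot all_order all_algebra.
From mathcomp Require Import all_classical all_reals all_analysis.
From mathcomp Require Import ring.

Set Implicit Arguments.
Unset Strict Implicit.
Unset Printing Implicit Defensive.

Import Order.TTheory GRing.Theory Num.Theory.
Import numFieldNormedType.Exports.

Local Open Scope classical_set_scope.
Local Open Scope ring_scope.

Section Curves.
Context {R : realType}.

(* Absolute continuity on [a, b].  For V = R * R * R the norm is the sup norm,
   which gives the same notion as the Euclidean norm. *)
Definition abs_continuous (V : normedModType R) (a b : R) (f : R -> V) : Prop :=
  forall e : R, 0 < e -> exists2 delta : R, 0 < delta &
    forall (n : nat) (l r : 'I_n -> R),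
      (forall i, a <= l i /\ l i <= r i /\ r i <= b) ->
      trivIset [set: 'I_n] (fun i => `]l i, r i[%classic) ->
      \sum_(i < n) (r i - l i) < delta ->
      \sum_(i < n) `|f (r i) - f (l i)| < e.

(* Metrics are given as functions T -> T -> \bar R, so that an infimum of
   lengths is a metric without any convention on inf. *)
Definition metric_curve (T : Type) (d : T -> T -> \bar R) (a b : R)
    (g : R -> T) : Prop :=
  forall s, a <= s <= b -> forall e : R, 0 < e ->
    exists2 delta : R, 0 < delta &
      forall s', a <= s' <= b -> `|s' - s| < delta -> (d (g s) (g s') < e%:E)%E.

(* As in [variation]: an [itv_partition a b p] lists the points after a. *)
Definition metric_length (T : Type) (d : T -> T -> \bar R) (a b : R)
    (g : R -> T) : \bar R :=
  ereal_sup [set (\sum_(0 <= i < size p)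
                    d (g (nth b (a :: p) i)) (g (nth b (a :: p) i.+1)))%E
            | p in itv_partition a b].

Definition quasiconvex_with (T : Type) (Z : set T) (d : T -> T -> \bar R)
    (c : R) : Prop :=
  forall u v, Z u -> Z v -> exists (a b : R) (g : R -> T),
    [/\ a <= b, g a = u & g b = v] /\
    [/\ forall s, a <= s <= b -> Z (g s),
        metric_curve d a b g,
        (metric_length d a b g < +oo)%E &
        (metric_length d a b g <= c%:E * d u v)%E].

Definition quasiconvex (T : Type) (Z : set T) (d : T -> T -> \bar R) : Prop :=
  exists2 c : R, 1 <= c & quasiconvex_with Z d c.

End Curves.

Definition nowhere_dense (T : topologicalType) (S : set T) : Prop :=
  interior (closure S) = set0.

Section Heisenberg.
Context {R : realType}.

Definition heis_mul (p q : R * R * R) : R * R * R :=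
  let: (x, y, t) := p in let: (x', y', t') := q in
  (x + x', y + y', t + t' + 2 * (x' * y - x * y')).

Definition heisX (p : R * R * R) : R * R * R := (1, 0, 2 * p.1.2).
Definition heisY (p : R * R * R) : R * R * R := (0, 1, - (2 * p.1.1)).

Definition horizontal (a b : R) (g : R -> R * R * R) (u v : R -> R) : Prop :=
  abs_continuous a b g /\
  {ae (@lebesgue_measure R), forall s, s \in `[a, b] ->
     is_derive s (1 : R) g (u s *: heisX (g s) + v s *: heisY (g s))}.

Definition cc_length (a b : R) (u v : R -> R) : \bar R :=
  (\int[@lebesgue_measure R]_(s in `[a, b])
     (Num.sqrt (u s ^+ 2 + v s ^+ 2))%:E)%E.

Definition d_cc (p q : R * R * R) : \bar R :=
  ereal_inf [set L | exists (a b : R) (g : R -> R * R * R) (u v : R -> R),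
    [/\ a <= b, g a = p, g b = q, horizontal a b g u v &
        L = cc_length a b u v]].

Definition pi_x (p : R * R * R) : R * R * R := heis_mul p (- p.1.1, 0, 0).
Definition pi_y (p : R * R * R) : R * R * R := heis_mul p (0, - p.1.2, 0).

Lemma pi_xE (x y t : R) : pi_x (x, y, t) = (0, y, t - 2 * x * y).
Proof. by rewrite /pi_x /heis_mul /=; congr (_, _, _); ring. Qed.

Lemma pi_yE (x y t : R) : pi_y (x, y, t) = (x, 0, t + 2 * x * y).
Proof. by rewrite /pi_y /heis_mul /=; congr (_, _, _); ring. Qed.

Definition yt_plane (z : R * R) : R * R * R := (0, z.1, z.2).
Definition xt_plane (z : R * R) : R * R * R := (z.1, 0, z.2).

End Heisenberg.

(* Main.v *)
(** The lines [p * (0, s, 0)] are the fibres of [pi_y] and the lines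
    [p * (s, 0, 0)] are the fibres of [pi_x], so such a line through a point
    whose projection lies off the closure of the projection of [A] avoids [A].
    Any [q] is [p * X^a * Y^b * X^c * Y^d] with [|a| + |b| + |c| + |d|] at most
    a gauge of [p^-1 * q], and right translations are homeomorphisms, so for a
    dense set of [p'] near [p] all four lines of the broken path from [p'] to
    [p' * X^a * Y^b * X^c * Y^d] avoid [A].  The two gaps, at [p] and at [q],
    are closed inside balls that miss the closed set [A].

    The gauge is at most [7 * d_cc p q]: along a horizontal curve of length [L]
    starting at the origin, [x] and [y] move by at most [L], and
    [t' = 2 (u y - v x)] gives [|t| <= 4 L^2].  This uses the inequality
    [|f b - f a| <= int |f'|] for absolutely continuous [f], which is proved
    with Cousin's lemma. *)

Require Import Defs.
From mathcomp Require Import all_boot all_order all_algebra.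
From mathcomp Require Import all_classical all_reals all_analysis.
From mathcomp Require Import measurable_realfun.
From mathcomp Require Import ring lra.

Set Implicit Arguments.
Unset Strict Implicit.
Unset Printing Implicit Defensive.

Import Order.TTheory GRing.Theory Num.Theory.
Import numFieldNormedType.Exports.

Local Open Scope classical_set_scope.
Local Open Scope ring_scope.

(** * Increments of absolutely continuous functions *)

(** The supremum of the points [x] with [Q a x] must be [b]: the local hypothesis reaches across it
    from a nearby such [x], and additivity then extends [Q] beyond it. *)
Lemma cousin (R : realType) (Q : R -> R -> Prop) (a b : R) : a <= b ->
  (forall l m r, a <= l -> l <= m -> m <= r -> r <= b -> Q l m -> Q m r ->
    Q l r) ->
  (forall s, a <= s <= b -> exists2 eta, 0 < eta &
    forall l r, a <= l -> l <= s -> s <= r -> r <= b -> r - l < eta ->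
      Q l r) ->
  Q a b.
Proof.
move=> ab Qcat Qloc.
pose S := [set x | a <= x <= b /\ Q a x].
have Sa : S a.
  split; first by rewrite lexx.
  have [|e e0 /(_ a a)] := Qloc a; first by rewrite lexx.
  by rewrite subrr; apply.
have Sub : has_ubound S by exists b => x [/andP[_ ->]].
have supS : has_sup S by split => //; exists a.
set s := sup S.
have as_ : a <= s by apply: ub_le_sup.
have sb : s <= b.
  by apply: ge_sup => //; [exists a|move=> x [/andP[_ ->]]].
have [|e e0 Qe] := Qloc s; first by rewrite as_ sb.
have [x [/andP[ax xb] Qax] sx] := sup_adherent (divr_gt0 e0 (ltr0Sn R 1)) supS.
have xs : x <= s by apply: ub_le_sup => //; split; rewrite ?ax.
(* As [x] is within [e / 2] of [s], a step of [e / 4] past [s] keeps [y - x < e]. *)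
pose y := Num.min b (s + e / 4).
have sy : s <= y by rewrite /y le_min sb /=; lra.
have yb : y <= b by rewrite /y ge_min lexx.
have ys4 : y <= s + e / 4 by rewrite /y ge_min lexx orbT.
have Sy : S y.
  split; first by rewrite yb (le_trans as_ sy).
  apply: (Qcat _ x) => //; first exact: le_trans sy.
  by apply: Qe => //; rewrite -/s in sx; lra.
have : y <= s by apply: ub_le_sup.
rewrite {1}/y ge_min => /orP[bs|]; last by lra.
suff <- : y = b by case: Sy.
by apply/eqP; rewrite eq_le yb (le_trans bs).
Qed.

Lemma lebesgue_measure_bounded_itv (R : realType) (x y : bool) (a b : R) :
  a <= b ->
  @lebesgue_measure R [set` Interval (BSide x a) (BSide y b)] = (b - a)%:E.
Proof.
move=> ab; rewrite (lebesgue_measure_itv (Interval (BSide x a) (BSide y b))).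
rewrite /= lte_fin EFinB; case: ifPn => //; rewrite -leNgt => ba.
by rewrite -EFinB (_ : b = a) ?subrr//; apply/eqP; rewrite eq_le ba.
Qed.

Lemma sum_disjoint_itv_le (R : realType) (n : nat) (l r : 'I_n -> R)
    (U : set R) (e : R) :
  open U -> (@lebesgue_measure R U < e%:E)%E ->
  (forall i, l i <= r i /\ `]l i, r i[ `<=` U) ->
  trivIset [set: 'I_n] (fun i => `]l i, r i[%classic) ->
  \sum_(i < n) (r i - l i) < e.
Proof.
move=> oU Ue lr tr; rewrite -lte_fin; apply: le_lt_trans Ue.
have -> : (\sum_(i < n) (r i - l i))%:E =
    lebesgue_measure (\big[setU/set0]_(i < n) `]l i, r i[%classic).
  rewrite measure_bigsetU_ord//.
  rewrite -sumEFin; apply: eq_bigr => i _.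
  by apply: esym; apply: lebesgue_measure_bounded_itv; case: (lr i).
apply: le_measure; rewrite ?inE.
- by apply: bigsetU_measurable => i _; exact: measurable_itv.
- exact: open_measurable.
- by rewrite -bigcup_seq => x [i _]; exact: (lr i).2.
Qed.

(* No measurability is required: the controls [u], [v] of a horizontal curve are
   only almost everywhere equal to measurable functions. *)
Lemma ge0_subset_le_integral d (T : measurableType d) (R : realType)
    (mu : {measure set T -> \bar R}) (A B : set T) (f g : T -> \bar R) :
  A `<=` B -> (forall x, A x -> (0 <= f x <= g x)%E) ->
  (forall x, B x -> (0 <= g x)%E) ->
  (\int[mu]_(x in A) f x <= \int[mu]_(x in B) g x)%E.
Proof.
move=> AB fg g0.
rewrite !ge0_integralE//; last by move=> x /fg /andP[].
apply: le_ereal_sup => _ [h /= hf <-]; exists h => //= x.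
apply: le_trans (hf x) _; rewrite /patch; case: ifPn => [/set_mem Ax|_].
  by rewrite mem_set; [case/andP: (fg _ Ax)|exact: AB].
by case: ifPn => [/set_mem /g0|].
Qed.

(** Only the largest layer containing [x] matters: if its index is [j], at most [j] terms are
    nonzero, and [j * e <= y]. The sum starts at layer 1 because layer 0 gives no positive lower
    bound for [y]. *)
Lemma sum_indic_layers_le (R : realType) (T : Type) (F : nat -> set T)
    (e : R) (n : nat) (x : T) (y : R) :
  0 < e -> 0 <= y -> (forall k, F k x -> k%:R * e <= y) ->
  \sum_(k < n) e * \1_(F k.+1) x <= y.
Proof.
move=> e0 y0 Fy; elim: n y y0 Fy => [|n IH] y y0 Fy; first by rewrite big_ord0.
rewrite big_ord_recr /=.
have [Fx|nFx] := pselect (F n.+1 x); last first.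
  by rewrite indicE memNset// mulr0 addr0 IH.
have ny := Fy _ Fx.
rewrite indicE mem_set// mulr1; apply: le_trans ny.
rewrite -natr1 mulrDl mul1r lerD2r -[n in n%:R]card_ord -sumr_const mulr_suml.
by apply: ler_sum => i _; rewrite mulrC ler_pM2r// indicE; case: (_ \in _).
Qed.

(** Clearing the denominator lets [x = s] take part, so later estimates need no punctured
    neighbourhood. *)
Lemma is_derive_distP (R : realType) (V : normedModType R) (f : R -> V)
    (s : R) (D : V) :
  is_derive s (1 : R) f D <->
  forall e, 0 < e -> exists2 eta, 0 < eta & forall x, `|x - s| < eta ->
    `|f x - f s - (x - s) *: D| <= e * `|x - s|.
Proof.
have quotE x : x - s != 0 -> (x - s)^-1 *: (f x - f s) - D =
    (x - s)^-1 *: (f x - f s - (x - s) *: D).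
  by move=> xs0; rewrite [in RHS]scalerBr scalerK.
split=> [[df fD] e e0|H].
  have : h^-1 *: ((f \o shift s) (h *: (1 : R)) - f s) @[h --> 0^'] --> D.
    by rewrite -fD; exact: df.
  move/cvgrPdist_le => /(_ _ e0); rewrite near_withinE.
  move=> /nbhs_ballP[eta /= eta0 H]; exists eta => // x xs.
  have [->|xneqs] := eqVneq x s.
    by rewrite !subrr scale0r subr0 !normr0 mulr0.
  have xs0 : x - s != 0 by rewrite subr_eq0.
  have := H (x - s); rewrite /ball /= sub0r normrN => /(_ xs xs0).
  rewrite [_ *: 1]mulr1 subrK distrC quotE// normrZ normfV mulrC.
  by rewrite ler_pdivrMr ?normr_gt0.
have cvgD : h^-1 *: ((f \o shift s) (h *: (1 : R)) - f s) @[h --> 0^'] --> D.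
  apply/cvgrPdist_le => e e0; have [eta eta0 He] := H e e0.
  rewrite near_withinE; apply/nbhs_ballP; exists eta => //= h.
  rewrite /ball /= sub0r normrN => heta h0.
  have hs : h + s - s = h by rewrite addrK.
  have := He (h + s); rewrite hs => /(_ heta) Hh.
  rewrite [_ *: 1]mulr1 distrC -{1}hs quotE ?hs// normrZ normfV mulrC.
  by rewrite ler_pdivrMr ?normr_gt0.
split; first by apply/cvg_ex; exists D.
exact: cvg_lim.
Qed.

Lemma is_derive_dist_le (R : realType) (f : R -> R) (s D e : R) :
  is_derive s (1 : R) f D -> 0 < e ->
  exists2 eta, 0 < eta & forall x, `|x - s| < eta ->
    `|f x - f s - D * (x - s)| <= e * `|x - s|.
Proof.
move=> /is_derive_distP H /H[eta eta0 He]; exists eta => // x /He.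
by rewrite [D * _]mulrC.
Qed.

Lemma is_derive_reparam (R : realType) (V : normedModType R) (f : R -> V)
    (k sg s : R) (D : V) : `|sg| = 1 ->
  is_derive (k + sg * s) (1 : R) f D ->
  is_derive s (1 : R) (fun x => f (k + sg * x)) (sg *: D).
Proof.
move=> sg1 /is_derive_distP H; apply/is_derive_distP => e /H[eta eta0 He].
have subE x : k + sg * x - (k + sg * s) = sg * (x - s) by ring.
exists eta => // x xs; have := He (k + sg * x).
by rewrite subE normrM sg1 mul1r scalerA [sg * (x - s)]mulrC; apply.
Qed.

(** As [s] lies between [l] and [r], the first-order errors at the two ends add up to at most
    [e * (r - l)]. *)
Lemma is_derive_straddle (R : realType) (f : R -> R) (s D e : R) :
  is_derive s (1 : R) f D -> 0 < e ->
  exists2 eta, 0 < eta & forall l r, l <= s -> s <= r -> r - l < eta ->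
    `|f r - f l| <= (`|D| + e) * (r - l).
Proof.
move=> fD e0; have [eta eta0 H] := is_derive_dist_le fD e0.
exists eta => // l r ls sr rl.
have /H Hr : `|r - s| < eta by rewrite ger0_norm; lra.
have /H Hl : `|l - s| < eta by rewrite ler0_norm; lra.
rewrite (_ : f r - f l = D * (r - l) +
  ((f r - f s - D * (r - s)) - (f l - f s - D * (l - s)))); last by ring.
apply: (le_trans (ler_normD _ _)).
rewrite mulrDl normrM (ger0_norm (_ : 0 <= r - l)); last by lra.
rewrite lerD2l (le_trans (ler_normB _ _))//.
rewrite (ler0_norm (_ : l - s <= 0)) in Hl; last by lra.
rewrite (ger0_norm (_ : 0 <= r - s)) in Hr; last by lra.
by have := lerD Hr Hl; rewrite -mulrDr; congr (_ <= e * _); ring.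
Qed.

(** The derivative is a pointwise limit of forward quotients with step [1 / (n + 1)], each of them
    measurable. *)
Lemma measurable_fun_is_derive (R : realType) (f D : R -> R) (E : set R) :
  measurable_fun setT f -> (forall s, E s -> is_derive s (1 : R) f (D s)) ->
  measurable E -> measurable_fun E D.
Proof.
move=> mf fD mE.
pose h n s := n.+1%:R * (f (s + n.+1%:R^-1) - f s).
apply: (@measurable_fun_cvg _ _ R E h D).
  move=> n; apply: measurable_funTS.
  apply: measurable_funM => //.
  apply: measurable_funB => //.
  apply: measurableT_comp => //.
  exact: measurable_funD.
move=> s Es; apply/cvgrPdist_le => e e0.
have [eta eta0 H] := is_derive_dist_le (fD s Es) e0.
near=> n.
have n0 : 0 < n.+1%:R^-1 :> R by rewrite invr_gt0.
have := H (s + n.+1%:R^-1); rewrite addrAC subrr add0r gtr0_norm//.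
have -> : n.+1%:R^-1 < eta.
  near: n; exact: (near_infty_natSinv_lt (PosNum eta0)).
move=> /(_ isT); rewrite -ler_pdivrMr// invrK.
rewrite -[X in _ * X <= _](gtr0_norm (ltr0Sn R n)) -normrM distrC.
rewrite /h; congr (`|_| <= _).
by field.
Unshelve. all: by end_near. Qed.

(** Cousin's lemma chains local estimates: near a point of [U] the increment is charged to an
    interval inside [U], elsewhere to [G]. *)
Lemma abs_continuous_increment_le (R : realType) (f G : R -> R) (a b e : R)
    (U : set R) : a <= b -> open U ->
  (forall l r, a <= l -> l <= r -> r <= b -> G l <= G r) ->
  (forall (n : nat) (l r : 'I_n -> R),
    (forall i, a <= l i /\ l i <= r i /\ r i <= b) ->
    trivIset [set: 'I_n] (fun i => `]l i, r i[%classic) ->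
    (forall i, `]l i, r i[ `<=` U) ->
    \sum_(i < n) `|f (r i) - f (l i)| < e) ->
  (forall s, a <= s <= b -> U s \/ exists2 eta, 0 < eta &
    forall l r, a <= l -> l <= s -> s <= r -> r <= b -> r - l < eta ->
      `|f r - f l| <= G r - G l) ->
  `|f b - f a| <= G b - G a + e.
Proof.
move=> ab oU ndG fU loc.
(* [Q] carries the family of intervals and not a bound on its sum: the bound [e] holds for a whole
   family at once and would double under concatenation. *)
pose Q u v := exists (n : nat) (l r : 'I_n -> R),
  [/\ forall i, u <= l i /\ l i <= r i /\ r i <= v,
      trivIset [set: 'I_n] (fun i => `]l i, r i[%classic),
      forall i, `]l i, r i[ `<=` U &
      `|f v - f u| <= G v - G u + \sum_(i < n) `|f (r i) - f (l i)|].
suff [n [l [r [lr tr lrU fab]]]] : Q a b.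
  by apply: (le_trans fab); rewrite lerD2l ltW// fU.
apply: cousin => //.
  move=> u v w au uv vw wb [n1 [l1 [r1 [lr1 tr1 U1 f1]]]].
  move=> [n2 [l2 [r2 [lr2 tr2 U2 f2]]]].
  pose join (g1 : 'I_n1 -> R) (g2 : 'I_n2 -> R) (i : 'I_(n1 + n2)) :=
    match fintype.split i with inl j => g1 j | inr j => g2 j end.
  exists (n1 + n2)%N, (join l1 l2), (join r1 r2); split.
  - move=> i; rewrite /join; case: (fintype.split i) => j.
      have [? [? ?]] := lr1 j; split=> //; split=> //; exact: le_trans vw.
    have [? [? ?]] := lr2 j; split=> //; exact: le_trans uv _.
  - move=> i j _ _; rewrite -[i]splitK -[j]splitK /join !unsplitK.
    case: (fintype.split i) => i'; case: (fintype.split j) => j' [x []] /=.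
    + by move=> h1 h2; congr (lshift _ _); apply: tr1 => //; exists x.
    + rewrite !in_itv /= => /andP[_ h1] /andP[h2 _].
      have [_ [_ h3]] := lr1 i'; have [h4 _] := lr2 j'; exfalso; lra.
    + rewrite !in_itv /= => /andP[h2 _] /andP[_ h1].
      have [_ [_ h3]] := lr1 j'; have [h4 _] := lr2 i'; exfalso; lra.
    + by move=> h1 h2; congr (rshift _ _); apply: tr2 => //; exists x.
  - move=> i; rewrite /join.
    by case: (fintype.split i) => j; [exact: U1|exact: U2].
  - rewrite big_split_ord /=.
    under eq_bigr do rewrite /join -[lshift _ _]/(unsplit (inl _)) unsplitK.
    under [X in _ + (_ + X)]eq_bigr do
      rewrite /join -[rshift _ _]/(unsplit (inr _)) unsplitK.
    rewrite (_ : f w - f u = (f w - f v) + (f v - f u)); last by ring.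
    by apply: (le_trans (ler_normD _ _)); lra.
move=> s sab; have [Us|[eta eta0 H]] := loc s sab; last first.
  exists eta => // l r al ls sr rb rl.
  exists 0%N, (fun=> 0), (fun=> 0); split=> [[]//|[]//|[]//|].
  by rewrite big_ord0 addr0 H.
have [eta /= eta0 HU] : nbhs_ball s U.
  by apply/nbhs_ballP; exact: open_nbhs_nbhs.
exists eta => // l r al ls sr rb rl.
exists 1%N, (fun=> l), (fun=> r); split.
- by move=> _; rewrite !lexx (le_trans ls sr).
- by move=> i j _ _ _; rewrite !ord1.
- move=> _ x /=; rewrite in_itv /= => /andP[lx xr]; apply: HU.
  by rewrite /ball /= ltr_norml; lra.
- by rewrite big_ord1 lerDr subr_ge0 ndG// (le_trans ls sr).
Qed.

(** Layer 0 costs at most [e * (b - a)]; the layers from 1 on, weighted by [e], add up pointwise to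
    at most [g]. *)
Lemma layer_measure_sum_le (R : realType) (a b e : R) (E : set R) (g : R -> R)
    (F : nat -> set R) (n : nat) :
  let mu : measure _ _ := @lebesgue_measure R in
  0 < e -> a <= b -> E `<=` `[a, b] -> measurable E -> measurable_fun E g ->
  (forall s, E s -> 0 <= g s) -> (forall k, measurable (F k)) ->
  (forall k, F k `<=` E) -> (forall k s, F k s -> k%:R * e <= g s) ->
  (e%:E * \sum_(k < n) mu (F k) <=
    (e * (b - a))%:E + \int[mu]_(s in E) (g s)%:E)%E.
Proof.
move=> mu e0 ab Eab mE mg g0 mF FE Fg.
have Ig0 : (0 <= \int[mu]_(s in E) (g s)%:E)%E.
  by apply: integral_ge0 => s Es; rewrite lee_fin g0.
case: n => [|n].
  by rewrite big_ord0 mule0 adde_ge0// lee_fin mulr_ge0 ?subr_ge0// ltW.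
rewrite big_ord_recl muleDr//; last first.
  by apply: ge0_adde_def; rewrite inE// sume_ge0.
apply: leeD.
  rewrite EFinM lee_pmul2l// ?lte_fin//.
  apply: (@le_trans _ _ (mu `[a, b]%classic)).
    apply: le_measure; rewrite ?inE//; first exact: mF.
    by move=> x /FE /Eab.
  by have -> : mu `[a, b]%classic = (b - a)%:E :=
    lebesgue_measure_bounded_itv _ _ ab.
rewrite ge0_sume_distrr//.
rewrite (_ : \sum_(i < n) _ =
    \int[mu]_(s in E) (\sum_(k < n) e * \1_(F k.+1) s)%:E)%E; last first.
  under eq_integral do rewrite -sumEFin.
  rewrite ge0_integral_sum//.
  - apply: eq_bigr => k _; under eq_integral do rewrite EFinM.
    rewrite ge0_integralZl//; last by rewrite lee_fin ltW.
      rewrite integral_indic//; last exact: mF.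
      by rewrite setIidl//; exact: FE.
    by apply/measurable_EFinP; apply: measurable_indic; exact: mF.
  - move=> k; apply/measurable_EFinP.
    apply: (@measurable_funM _ _ _ _ (cst e)); first exact: measurable_cst.
    by apply: measurable_indic; exact: mF.
  - by move=> k x _; rewrite lee_fin mulr_ge0// ltW.
apply: ge0_subset_le_integral => // s Es.
apply/andP; split.
  by rewrite lee_fin sumr_ge0// => i _; rewrite mulr_ge0// ltW.
rewrite lee_fin; apply: sum_indic_layers_le => //; first exact: g0.
by move=> k; exact: Fg.
Qed.

(* A layer-cake form of the Vitali-Caratheodory theorem: [G] is the distribution
   function of [e' * \sum_k mu (O_k `&` _)], where the open set [O_k] is barely
   larger than [[set s | k * e' <= g s]]. *)
Lemma integral_majorant (R : realType) (a b e : R) (E : set R) (g : R -> R) :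
  let mu : measure _ _ := @lebesgue_measure R in
  0 < e -> a <= b -> E `<=` `[a, b] -> measurable E -> measurable_fun E g ->
  (forall s, E s -> 0 <= g s) ->
  (\int[mu]_(s in E) (g s)%:E < +oo)%E ->
  exists G : R -> R,
    [/\ forall l r, l <= r -> G l <= G r,
        ((G b - G a)%:E <= \int[mu]_(s in E) (g s)%:E + e%:E)%E &
        forall s, E s -> exists2 eta, 0 < eta &
          forall l r, l <= s -> s <= r -> r - l < eta ->
            g s * (r - l) <= G r - G l].
Proof.
move=> mu e0 ab Eab mE mg g0 Igoo.
(* Layer 0 uses up [e' * (b - a)], and the excesses [1 / 2 ^ (k + 1)] of the open sets, which sum to
   1, use up another [e']. *)
pose e' := e / (b - a + 1).
have e'0 : 0 < e' by apply: divr_gt0 => //; lra.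
pose F k := E `&` [set s | k%:R * e' <= g s].
have mF k : measurable (F k) by apply: measurable_fun_le.
have FE k : F k `<=` E by exact: subIsetl.
have Fg k s : F k s -> k%:R * e' <= g s by case.
have muab : (mu `[a, b]%classic < +oo)%E.
  have -> : mu `[a, b]%classic = (b - a)%:E :=
    lebesgue_measure_bounded_itv _ _ ab.
  exact: ltry.
have muF k : (mu (F k) < +oo)%E.
  apply: le_lt_trans muab; apply: le_measure; rewrite ?inE//; first exact: mF.
  by move=> x /FE /Eab.
have /choice [ O HO] : forall k, exists U : set R, [/\ open U, F k `<=` U &
    (mu (U `\` F k) < (1 / (2 ^ (k + 1))%:R)%:E)%E].
  move=> k; apply: lebesgue_regularity_outer; [exact: mF|exact: muF|].
  by rewrite divr_gt0// ltr0n expn_gt0.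
have oO k : open (O k) by case: (HO k).
have FO k : F k `<=` O k by case: (HO k).
have mO k : measurable (O k) by apply: open_measurable.
have muO k : (mu (O k) <= mu (F k) + (1 / (2 ^ (k + 1))%:R)%:E)%E.
  have [_ _ /ltW OF] := HO k; apply: le_trans (leeD2l _ OF).
  rewrite -[in leLHS](setDUK (FO k)); apply: measureU2; first exact: mF.
  by apply: measurableD; [exact: mO|exact: mF].
pose m k : measure _ _ := mrestr mu (mO k).
pose nu : measure _ _ := mseries m 0.
pose I := fine (\int[mu]_(s in E) (g s)%:E).
have IE : (\int[mu]_(s in E) (g s)%:E = I%:E)%E.
  rewrite fineK// ge0_fin_numE//.
  by apply: integral_ge0 => s Es; rewrite lee_fin g0.
have nuT : (e'%:E * nu setT <= I%:E + e%:E)%E.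
  have : (nu setT <= \sum_(0 <= k <oo) mu (F k) +
      \sum_(0 <= k <oo) (1 / (2 ^ (k + 1))%:R)%:E)%E.
    rewrite -nneseriesD; [|by move=> *; exact: measure_ge0|]; last first.
      by move=> k _ _; rewrite lee_fin divr_ge0.
    apply: lee_nneseries => [k _ _|k _]; first exact: measure_ge0.
    by have -> : m k setT = mu (O k) := congr1 mu (setTI (O k)); exact: muO.
  have -> : (\sum_(0 <= k <oo) (1 / (2 ^ (k + 1))%:R)%:E)%E = 1%:E :> \bar R.
    by apply/cvg_lim => //; have := @cvg_geometric_eseries_half R 1 0;
      rewrite expr0 divr1.
  move=> H; have := lee_wpmul2l (_ : 0 <= e'%:E)%E H.
  rewrite lee_fin ltW// => /(_ isT) /le_trans; apply.
  rewrite ge0_muleDr//; last exact: nneseries_ge0.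
  have HF : (e'%:E * \sum_(0 <= k <oo) mu (F k) <=
      (e' * (b - a))%:E + I%:E)%E.
    rewrite -nneseriesZl; [|by move=> *; exact: measure_ge0].
    apply: lime_le.
      apply: is_cvg_nneseries => k _ _.
      by rewrite mule_ge0// lee_fin ltW.
    apply: nearW => n; rewrite -ge0_sume_distrr// big_mkord -IE.
    exact: layer_measure_sum_le.
  apply: le_trans (leeD2r _ HF) _; rewrite mule1 -!EFinD lee_fin.
  suff -> : e = e' * (b - a) + e' by lra.
  by rewrite /e'; field; lra.
have nufin A : measurable A -> nu A \is a fin_num.
  move=> mA; rewrite ge0_fin_numE//.
  apply: (@le_lt_trans _ _ (nu setT)); first by apply: le_measure; rewrite ?inE.
  move: nuT; case: (nu setT) => [r||] //=; first by rewrite ltry.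
  by rewrite gt0_muley ?lte_fin.
pose G s := e' * fine (nu `]-oo, s]%classic).
have GB l r : l <= r -> G r - G l = e' * fine (nu `]l, r]%classic).
  move=> lr; rewrite /G -mulrBr; congr (_ * _).
  have -> : `]-oo, r]%classic = `]-oo, l]%classic `|` `]l, r]%classic.
    apply/seteqP; split => x /=; rewrite !in_itv /=.
      by case: (leP x l) => _ ->; [left|right].
    by move=> [/le_trans->|/andP[_ ->]].
  rewrite measureU//; try exact: measurable_itv.
    by rewrite fineD; [rewrite addrAC subrr add0r|exact: nufin|exact: nufin].
  apply/seteqP; split => x //=; rewrite !in_itv /= => -[h1 /andP[h2 _]]; lra.
exists G; split.
- by move=> l r lr; rewrite -subr_ge0 GB// mulr_ge0// ?fine_ge0// ltW.
- rewrite GB// IE (le_trans _ nuT)// EFinM lee_pmul2l// ?lte_fin//.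
  by rewrite fineK ?nufin//; apply: le_measure; rewrite ?inE.
move=> s Es.
(* The point [s] lies in the layers [0] to [k], so short intervals around it lie in [k + 1] of the
   sets [O j], and [(k + 1) * e'] exceeds [g s]. Layer 0 makes up for the truncation. *)
pose k := Num.trunc (g s / e').
have /andP[k1 k2] : k%:R <= g s / e' < k.+1%:R.
  by apply: trunc_itv; rewrite divr_ge0 ?g0// ltW.
rewrite ler_pdivlMr// in k1; rewrite ltr_pdivrMr// in k2.
have : \forall x \near s, forall j : 'I_k.+1, O j x.
  apply: (@filter_forall _ _ (fun (j : 'I_k.+1) x => O j x) (nbhs s) _) => j.
  apply: open_nbhs_nbhs; split => //.
  apply: FO; split => //=; apply: le_trans k1.
  by rewrite ler_pM2r// ler_nat -ltnS.
move=> /nbhs_ballP[eta /= eta0 HO'].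
exists eta => // l r ls sr rl.
have lr : l <= r := le_trans ls sr.
rewrite GB//; apply: (@le_trans _ _ (e' * (k.+1%:R * (r - l)))).
  by rewrite mulrA ler_wpM2r ?subr_ge0// mulrC ltW.
rewrite ler_pM2l// -lee_fin fineK ?nufin//.
apply: le_trans (nneseries_lim_ge k.+1 _) => //.
rewrite big_mkord (eq_bigr (fun=> (r - l)%:E)).
  by rewrite sumEFin sumr_const card_ord mulr_natl.
move=> j _; rewrite /m /= /mrestr setIidl.
  exact: lebesgue_measure_bounded_itv.
move=> x /=; rewrite in_itv /= => /andP[lx xr].
by apply: (HO' x); rewrite /ball /= ltr_norml; lra.
Qed.

Lemma abs_continuous_dist (R : realType) (V : normedModType R) (f : R -> V)
    (a b e : R) : abs_continuous a b f -> 0 < e ->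
  exists2 delta, 0 < delta & forall x y, a <= x -> x <= y -> y <= b ->
    y - x < delta -> `|f y - f x| < e.
Proof.
move=> fAC e0; have [delta delta0 H] := fAC e e0.
exists delta => // x y ax xy yb xyd.
have := H 1%N (fun=> x) (fun=> y); rewrite !big_ord1; apply => //.
by move=> i j _ _ _; rewrite !ord1.
Qed.

(** Extending [f] by constants beyond the ends makes it continuous, hence measurable, on the whole
    line, as the measurability of its derivative requires. *)
Lemma abs_continuous_clamp (R : realType) (f : R -> R) (a b : R) :
  a <= b -> abs_continuous a b f ->
  continuous (fun s => f (Num.max a (Num.min b s))).
Proof.
move=> ab fAC s; apply/cvgrPdist_lt => e e0.
have [delta delta0 H] := abs_continuous_dist fAC e0.
near=> t.
have st : `|s - t| < delta.
  by near: t; apply: cvgr_dist_lt => //; exact: cvg_id.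
have clamp x : a <= Num.max a (Num.min b x) <= b.
  by rewrite le_max lexx /= ge_max ab ge_min lexx.
have clampB x y : x <= y -> 0 <= Num.max a (Num.min b y) -
    Num.max a (Num.min b x) <= y - x.
  move=> xy; case: (leP b x) => ?; case: (leP b y) => ?;
    do 2?case: (leP a) => ?; apply/andP; split; lra.
have /andP[? ?] := clamp s; have /andP[? ?] := clamp t.
have [/clampB /andP[h1 h2]|/ltW /clampB /andP[h1 h2]] := leP s t.
- rewrite distrC; apply: H => //; first by rewrite -subr_ge0.
  apply: le_lt_trans h2 _; apply: le_lt_trans st.
  by rewrite distrC ler_norm.
- apply: H => //; first by rewrite -subr_ge0.
  by apply: le_lt_trans h2 _; apply: le_lt_trans st; rewrite ler_norm.
Unshelve. all: by end_near. Qed.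

(* Off an open set of small measure containing the exceptional null set,
   increments of [f] are controlled by those of [G]; absolute continuity pays
   for the rest. *)
Lemma abs_continuous_le_integral (R : realType) (a b : R) (f D phi : R -> R) :
  a <= b -> abs_continuous a b f ->
  {ae (@lebesgue_measure R), forall s, s \in `[a, b] ->
     is_derive s (1 : R) f (D s) /\ `|D s| <= phi s} ->
  (forall s, 0 <= phi s) ->
  (`|f b - f a|%:E <= \int[@lebesgue_measure R]_(s in `[a, b]) (phi s)%:E)%E.
Proof.
move=> ab fAC [N [mN N0 HN]] phi0.
set J := (\int[_]_(_ in _) _)%E.
have [Joo|Joo] := ltP J +oo%E; last exact: le_trans (leey _) Joo.
pose E := `]a, b[%classic `\` N.
have mE : measurable E by apply: measurableD => //; exact: measurable_itv.
have DE s : E s -> is_derive s (1 : R) f (D s) /\ `|D s| <= phi s.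
  move=> [/= sab Ns]; apply: contrapT => ns; apply: Ns; apply: HN => /= H.
  by apply: ns; apply: H; exact: subset_itv_oo_cc.
have Eab : E `<=` `[a, b].
  by move=> s [/= sab _]; exact: subset_itv_oo_cc.
have mD : measurable_fun E D.
  apply: (measurable_fun_is_derive
    (continuous_measurable_fun (abs_continuous_clamp ab fAC))) => // s Es.
  apply: near_eq_is_derive (proj1 (DE s Es)).
  case: Es => /= sab _; near=> t.
  have : t \in `]a, b[ by near: t; exact: near_in_itvoo.
  by rewrite in_itv /= => /andP[/ltW ta /ltW tb]; rewrite min_r// max_r.
have mnD : measurable_fun E (fun s => `|D s|).
  by apply: measurableT_comp => //; exact: measurable_normr.
have ID : (\int[@lebesgue_measure R]_(s in E) `|D s|%:E <= J)%E.
  apply: ge0_subset_le_integral => // s; last by rewrite lee_fin.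
  by move=> /DE[_ Ds]; rewrite !lee_fin normr_ge0.
apply/lee_addgt0Pr => e e0.
(* The costs are [e' * (b - a)] for the linear term added to [G], [e'] for the excess of the
   majorant and [e'] for the increments inside [U]. *)
pose e' := e / (b - a + 2).
have e'0 : 0 < e' by rewrite divr_gt0//; lra.
have [delta delta0 HAC] := fAC e' e'0.
have [G [ndG Gab GE]] := integral_majorant e'0 ab Eab mE mnD
  (fun s _ => normr_ge0 _) (le_lt_trans ID Joo).
(* The endpoints join the null set because [E] lies in the open interval. *)
pose N' := N `|` ([set a] `|` [set b]).
have mN' : measurable N' by do !apply: measurableU => //.
have N'0 : (lebesgue_measure N' = 0)%E.
  rewrite measureU0//; first exact: measurableU.
  by rewrite measureU0//; exact: lebesgue_measure_set1.
have N'oo : (lebesgue_measure N' < +oo)%E by rewrite N'0.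
have [U [oU NU UN]] := lebesgue_regularity_outer mN' N'oo delta0.
have Udelta : (lebesgue_measure U < delta%:E)%E.
  apply: le_lt_trans UN; rewrite -[in leLHS](setDUK NU).
  have mUN : measurable (U `\` N').
    by apply: measurableD => //; exact: open_measurable.
  apply: le_trans (measureU2 _ mN' mUN) _.
  by rewrite [X in (X + _ <= _)%E]N'0 add0e.
have := @abs_continuous_increment_le R f (fun s => G s + e' * s) a b e' U ab oU.
have -> : (G b + e' * b - (G a + e' * a) + e' = G b - G a + e' * (b - a + 1)).
  by ring.
move=> H.
have {H} : `|f b - f a| <= G b - G a + e' * (b - a + 1).
  apply: H.
  - by move=> l r _ lr _; rewrite lerD ?ndG// ler_pM2l.
  - move=> n l r lr tr lrU; apply: HAC => //.
    apply: (sum_disjoint_itv_le oU Udelta) => // i.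
    by split; [case: (lr i) => _ []|exact: lrU].
  - move=> s /andP[as_ sb].
    have [N's|N's] := pselect (N' s); first by left; exact: NU.
    right.
    have Es : E s.
      split=> /=; last by move=> ?; apply: N's; left.
      rewrite in_itv /= !lt_neqAle as_ sb !andbT; apply/andP; split.
        by apply/eqP => sa; apply: N's; right; left.
      by apply/eqP => sa; apply: N's; right; right.
    have [d1 d10 H1] := is_derive_straddle (proj1 (DE s Es)) e'0.
    have [d2 d20 H2] := GE s Es.
    exists (Num.min d1 d2); first by rewrite lt_min d10.
    move=> l r _ ls sr _; rewrite lt_min => /andP[h1 h2].
    apply: le_trans (H1 _ _ ls sr h1) _.
    by have := H2 _ _ ls sr h2; lra.
rewrite -lee_fin EFinD => /le_trans; apply.
apply: le_trans (leeD2r _ (le_trans Gab (leeD2r _ ID))) _.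
rewrite -addeA leeD2l// -EFinD lee_fin.
suff : e = e' * (b - a + 2) by lra.
by rewrite /e'; field; lra.
Unshelve. all: by end_near. Qed.

(** * Lower bound on the distance *)

Lemma ae_lebesgue_imply (R : realType) (P Q : R -> Prop) :
  (forall s, P s -> Q s) -> {ae (@lebesgue_measure R), forall s, P s} ->
  {ae (@lebesgue_measure R), forall s, Q s}.
Proof.
move=> PQ [N [mN N0 HN]]; exists N; split => // s /= nQ.
by apply: HN => /= /PQ.
Qed.

Section Coordinates.
Context {R : realType}.
Implicit Types (p q : R * R * R) (g : R -> R * R * R).

(** General linear functionals serve both for the coordinates and, up to an additive constant, for
    [heis_t p] with [p] fixed. *)
Definition lin3 (al be ga : R) p : R := al * p.1.1 + be * p.1.2 + ga * p.2.

Lemma lin3x p : lin3 1 0 0 p = p.1.1.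
Proof. by rewrite /lin3 mul1r !mul0r !addr0. Qed.

Lemma lin3y p : lin3 0 1 0 p = p.1.2.
Proof. by rewrite /lin3 mul1r !mul0r addr0 add0r. Qed.

Lemma lin3B al be ga p q :
  lin3 al be ga (p - q) = lin3 al be ga p - lin3 al be ga q.
Proof. by case: p q => [[x y] t] [[x' y'] t']; rewrite /lin3 /=; ring. Qed.

Lemma lin3Z al be ga k p : lin3 al be ga (k *: p) = k * lin3 al be ga p.
Proof.
case: p => [[x y] t].
rewrite (_ : k *: _ = (k * x, k * y, k * t))//.
by rewrite /lin3 /=; ring.
Qed.

Lemma lin3_le al be ga p :
  `|lin3 al be ga p| <= (`|al| + `|be| + `|ga|) * `|p|.
Proof.
case: p => [[x y] t]; rewrite /lin3 /= !prod_normE /=.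
set m := Num.max _ _.
have xm : `|x| <= m by rewrite !le_max lexx.
have ym : `|y| <= m by rewrite !le_max lexx orbT.
have tm : `|t| <= m by rewrite le_max lexx orbT.
rewrite !mulrDl (le_trans (ler_normD _ _))//.
rewrite lerD//; last by rewrite normrM ler_wpM2l.
rewrite (le_trans (ler_normD _ _))// !normrM lerD// ler_wpM2l//.
Qed.

Lemma continuous_lin3 al be ga : continuous (lin3 al be ga).
Proof.
move=> p; apply: cvgD; [apply: cvgD|]; apply: cvgMr.
- apply: (@cvg_comp _ _ _ fst fst); [exact: cvg_fst|exact: cvg_fst].
- apply: (@cvg_comp _ _ _ fst snd); [exact: cvg_fst|exact: cvg_snd].
- exact: cvg_snd.
Qed.

Lemma is_derive_lin3 al be ga g s Dg : is_derive s (1 : R) g Dg ->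
  is_derive s (1 : R) (lin3 al be ga \o g) (lin3 al be ga Dg).
Proof.
move=> [dg gD].
have cvg_lin : h^-1 *: ((lin3 al be ga \o g \o shift s) (h *: (1 : R)) -
    (lin3 al be ga \o g) s) @[h --> 0^'] --> lin3 al be ga Dg.
  rewrite -gD.
  under eq_fun do rewrite /= -lin3B -[_ *: _]/(_ * _) -lin3Z.
  by apply: continuous_cvg; [exact: continuous_lin3|exact: dg].
split; first by apply/cvg_ex; exists (lin3 al be ga Dg).
exact: cvg_lim.
Qed.

Lemma abs_continuous_lin3 al be ga a b g :
  abs_continuous a b g -> abs_continuous a b (lin3 al be ga \o g).
Proof.
move=> gAC e e0; pose K := `|al| + `|be| + `|ga| + 1.
have K0 : 0 < K by rewrite ltr_wpDl// !addr_ge0.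
have [delta delta0 H] := gAC _ (divr_gt0 e0 K0).
exists delta => // n l r lr tr sd.
have := H n l r lr tr sd; rewrite ltr_pdivlMr// mulr_suml.
apply: le_lt_trans; apply: ler_sum => i _ /=.
rewrite -lin3B (le_trans (lin3_le _ _ _ _))// mulrC ler_wpM2l//.
by rewrite lerDl.
Qed.

Lemma horizontal_lin3_le al be ga a b g (u v : R -> R) :
  a <= b -> horizontal a b g u v ->
  (forall s, a <= s <= b ->
    `|lin3 al be ga (u s *: heisX (g s) + v s *: heisY (g s))| <=
      Num.sqrt (u s ^+ 2 + v s ^+ 2)) ->
  (`|lin3 al be ga (g b) - lin3 al be ga (g a)|%:E <= cc_length a b u v)%E.
Proof.
move=> ab [gAC gD] bnd.
apply: (@abs_continuous_le_integral R a b (lin3 al be ga \o g)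
  (fun s => lin3 al be ga (u s *: heisX (g s) + v s *: heisY (g s)))) => //.
  exact: abs_continuous_lin3.
apply: ae_lebesgue_imply gD => s Hs sab.
split; first by apply: is_derive_lin3; exact: Hs.
by apply: bnd; rewrite in_itv /= in sab.
Qed.

Lemma lin3_horizontalE al be ga (u v : R) p :
  lin3 al be ga (u *: heisX p + v *: heisY p) =
  al * u + be * v + ga * (2 * (u * p.1.2 - v * p.1.1)).
Proof.
rewrite (_ : u *: heisX p + v *: heisY p =
  (u * 1 + v * 0, u * 0 + v * 1, u * (2 * p.1.2) + v * - (2 * p.1.1)))//.
by rewrite /lin3 /=; ring.
Qed.

Lemma horizontal_sub a b c g (u v : R -> R) :
  c <= b -> horizontal a b g u v -> horizontal a c g u v.
Proof.
move=> cb [gAC gD]; split.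
  move=> e /gAC[delta delta0 H]; exists delta => // n l r lr; apply: H => i.
  by have [? [? ?]] := lr i; split => //; split => //; exact: le_trans cb.
apply: ae_lebesgue_imply gD => s Hs sac; apply: Hs.
by move: sac; rewrite !in_itv /= => /andP[-> /le_trans->].
Qed.

Lemma normr_le_sqrtrDl (x y : R) : `|x| <= Num.sqrt (x ^+ 2 + y ^+ 2).
Proof. by rewrite -sqrtr_sqr ler_wsqrtr// lerDl sqr_ge0. Qed.

Lemma normr_le_sqrtrDr (x y : R) : `|y| <= Num.sqrt (x ^+ 2 + y ^+ 2).
Proof. by rewrite addrC normr_le_sqrtrDl. Qed.

(** This is the [t]-coordinate of [p^-1 * q]. *)
Definition heis_t p q : R :=
  q.2 - p.2 + 2 * (p.1.1 * q.1.2 - q.1.1 * p.1.2).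

(** Along the curve, [heis_t (g a)] has derivative [2 (u dy - v dx)], where [dx] and [dy] are the
    displacements from [g a]. They are at most [r] on every initial arc, so this derivative is at
    most [4 * r] times the speed. *)
Lemma horizontal_coord_le a b g (u v : R -> R) (r : R) :
  a <= b -> horizontal a b g u v -> (cc_length a b u v < r%:E)%E ->
  [/\ `|(g b).1.1 - (g a).1.1| <= r, `|(g b).1.2 - (g a).1.2| <= r &
      `|heis_t (g a) (g b)| <= 4 * r ^+ 2].
Proof.
move=> ab hg Lr.
have L0 : (0 <= cc_length a b u v)%E.
  by apply: integral_ge0 => s _; rewrite lee_fin sqrtr_ge0.
have r0 : 0 < r by rewrite -lte_fin (le_lt_trans L0).
have Lsub s : a <= s <= b -> (cc_length a s u v <= cc_length a b u v)%E.
  move=> /andP[_ sb]; apply: ge0_subset_le_integral.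
  - by move=> x /=; rewrite !in_itv /= => /andP[-> /le_trans->].
  - by move=> x _; rewrite lexx andbT lee_fin sqrtr_ge0.
  - by move=> x _; rewrite lee_fin sqrtr_ge0.
have dx s : a <= s <= b -> `|(g s).1.1 - (g a).1.1| <= r.
  move=> /[dup] sab /andP[as_ sb].
  rewrite -lee_fin -(lin3x (g s)) -(lin3x (g a)).
  apply: le_trans (ltW (le_lt_trans (Lsub s sab) Lr)).
  apply: (horizontal_lin3_le as_ (horizontal_sub sb hg)) => t _.
  rewrite lin3_horizontalE mul1r !mul0r !addr0.
  exact: normr_le_sqrtrDl.
have dy s : a <= s <= b -> `|(g s).1.2 - (g a).1.2| <= r.
  move=> /[dup] sab /andP[as_ sb].
  rewrite -lee_fin -(lin3y (g s)) -(lin3y (g a)).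
  apply: le_trans (ltW (le_lt_trans (Lsub s sab) Lr)).
  apply: (horizontal_lin3_le as_ (horizontal_sub sb hg)) => t _.
  rewrite lin3_horizontalE mul1r !mul0r addr0 add0r.
  exact: normr_le_sqrtrDr.
split; [apply: dx|apply: dy|]; rewrite ?lexx ?ab//.
have r4 : 0 < 4 * r by lra.
(* The coefficients are those of [heis_t (g a)], divided by [4 * r] so that the derivative is
   bounded by the speed. *)
have := @horizontal_lin3_le
  (- 2 * (g a).1.2 / (4 * r)) (2 * (g a).1.1 / (4 * r))
  (4 * r)^-1 a b g u v ab hg.
set f := lin3 _ _ _.
have -> : f (g b) - f (g a) = heis_t (g a) (g b) / (4 * r).
  by rewrite /f /lin3 /heis_t; field; lra.
rewrite normrM (gtr0_norm (_ : 0 < (4 * r)^-1)) ?invr_gt0// => H.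
have {}H : ((`|heis_t (g a) (g b)| * (4 * r)^-1)%:E < r%:E)%E.
  apply: le_lt_trans Lr; apply: H => s sab; rewrite /f lin3_horizontalE.
  rewrite [X in `|X|](_ : _ = (2 * (u s * ((g s).1.2 - (g a).1.2) -
    v s * ((g s).1.1 - (g a).1.1))) / (4 * r)); last by field; lra.
  rewrite normrM (gtr0_norm (_ : 0 < (4 * r)^-1)) ?invr_gt0//.
  rewrite ler_pdivrMr// normrM (gtr0_norm (ltr0Sn _ 1)).
  have := ler_normB (u s * ((g s).1.2 - (g a).1.2))
    (v s * ((g s).1.1 - (g a).1.1)).
  rewrite !normrM.
  have := ler_pM (normr_ge0 _) (normr_ge0 _)
    (normr_le_sqrtrDl (u s) (v s)) (dy s sab).
  have := ler_pM (normr_ge0 _) (normr_ge0 _)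
    (normr_le_sqrtrDr (u s) (v s)) (dx s sab).
  lra.
move: H; rewrite lte_fin ltr_pdivrMr// => /ltW; congr (_ <= _); ring.
Qed.

End Coordinates.

(** * Curves of unit speed *)

Section UnitCurves.
Context {R : realType}.
Implicit Types (p q : R * R * R) (g : R -> R * R * R) (u v : R -> R).
Implicit Types (l : seq R) (Z : set (R * R * R)).

(** A Lipschitz bound and a finite list of exceptional points survive concatenation without any
    measure theory. Unit controls make the cc-length equal to [b - a]. *)
Definition unit_curve (a b : R) g u v l : Prop :=
  [/\ exists2 K, 0 <= K & forall s s', a <= s <= b -> a <= s' <= b ->
        `|g s' - g s| <= K * `|s' - s|,
      forall s, u s ^+ 2 + v s ^+ 2 = 1 &
      forall s, a < s < b -> s \notin l ->
        is_derive s (1 : R) g (u s *: heisX (g s) + v s *: heisY (g s))].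

Lemma unit_curve_sub a b a' b' g u v l : a <= a' -> b' <= b ->
  unit_curve a b g u v l -> unit_curve a' b' g u v l.
Proof.
move=> aa' bb' [[K K0 gK] uv1 gD]; split => //.
  exists K => // s s' /andP[a's sb'] /andP[a's' s'b'].
  by apply: gK; apply/andP; split; lra.
by move=> s /andP[a's sb']; apply: gD; apply/andP; split; lra.
Qed.

(** This covers translation of time ([sg = 1]) and its reversal ([sg = -1]); as [sg * sg = 1], the
    inverse substitution is [sg * (x - k)]. *)
Lemma unit_curve_reparam a b a' b' k sg g u v l : `|sg| = 1 ->
  (forall s, a' <= s <= b' -> a <= k + sg * s <= b) ->
  (forall s, a' < s < b' -> a < k + sg * s < b) ->
  unit_curve a b g u v l ->
  unit_curve a' b' (fun s => g (k + sg * s)) (fun s => sg * u (k + sg * s))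
    (fun s => sg * v (k + sg * s)) [seq sg * (x - k) | x <- l].
Proof.
move=> sg1 le_k lt_k [[K K0 gK] uv1 gD].
have sgsg : sg * sg = 1 
  by rewrite -expr2 -real_normK ?num_real// sg1 expr1n.
split.
- exists K => // s s' /le_k hs /le_k hs'; apply: le_trans (gK _ _ hs hs') _.
  rewrite (_ : k + sg * s' - _ = sg * (s' - s)); last by ring.
  by rewrite normrM sg1 mul1r.
- by move=> s; rewrite !exprMn -mulrDr uv1 expr2 sgsg mulr1.
- move=> s /lt_k hs sl.
  rewrite -!scalerA -scalerDr; apply: is_derive_reparam => //; apply: gD => //.
  apply: contra sl => sl; apply/mapP; exists (k + sg * s) => //.
  by rewrite addrAC subrr add0r mulrA sgsg mul1r.
Qed.

(** The one-sided derivatives may differ at the junction [b], which therefore becomes exceptional;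
    increments across it are split there. *)
Lemma unit_curve_cat a b c g1 u1 v1 l1 g2 u2 v2 l2 : a <= b -> b <= c ->
  g1 b = g2 b -> unit_curve a b g1 u1 v1 l1 -> unit_curve b c g2 u2 v2 l2 ->
  unit_curve a c (fun s => if s <= b then g1 s else g2 s)
    (fun s => if s <= b then u1 s else u2 s)
    (fun s => if s <= b then v1 s else v2 s) (b :: l1 ++ l2).
Proof.
move=> ab bc g12 [[K1 K10 gK1] uv1 gD1] [[K2 K20 gK2] uv2 gD2].
pose g s := if s <= b then g1 s else g2 s.
split.
- exists (K1 + K2); first exact: addr_ge0.
  suff H s s' : s <= s' -> a <= s <= c -> a <= s' <= c ->
      `|g s' - g s| <= (K1 + K2) * `|s' - s|.
    move=> s s' hs hs'; have [ss'|/ltW ss'] := leP s s'; first exact: H.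
    by rewrite distrC [X in _ * X]distrC; exact: H.
  move=> ss' /andP[as_ sc] /andP[as' s'c]; rewrite /g.
  case: (leP s b) => sb; case: (leP s' b) => s'b; last 2 first.
  + by exfalso; lra.
  + apply: le_trans (gK2 s s' _ _) _; try by apply/andP; split; lra.
    by rewrite ler_wpM2r// lerDr.
  + apply: le_trans (gK1 s s' _ _) _; try by apply/andP; split; lra.
    by rewrite ler_wpM2r// lerDl.
  + rewrite (_ : g2 s' - g1 s = (g2 s' - g2 b) + (g1 b - g1 s)); last first.
      by rewrite g12 addrA subrK.
    have h2 : `|g2 s' - g2 b| <= K2 * `|s' - b|.
      by apply: gK2; apply/andP; split; lra.
    have h1 : `|g1 b - g1 s| <= K1 * `|b - s|.
      by apply: gK1; apply/andP; split; lra.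
    apply: le_trans (ler_normD _ _) _; apply: le_trans (lerD h2 h1) _.
    rewrite !ger0_norm; [|lra|lra|lra].
    have : 0 <= K1 * (s' - b) by rewrite mulr_ge0//; lra.
    have : 0 <= K2 * (b - s) by rewrite mulr_ge0//; lra.
    by lra.
- by move=> s; case: ifP.
- move=> s /andP[as_ sc]; rewrite inE mem_cat !negb_or => /and3P[sb sl1 sl2].
  have [sb'|sb'] := leP s b.
    have {}sb' : s < b by rewrite lt_neqAle sb.
    apply: near_eq_is_derive (gD1 s _ sl1); last by rewrite as_.
    near=> t; have /ltW -> // : t < b by near: t; exact: lt_nbhsl.
  apply: near_eq_is_derive (gD2 s _ sl2); last by rewrite sb'.
  near=> t; have : b < t by near: t; exact: lt_nbhsr.
  by rewrite ltNge => /negbTE ->.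
Unshelve. all: by end_near. Qed.

Lemma unit_curve_horizontal a b g u v l : unit_curve a b g u v l ->
  horizontal a b g u v.
Proof.
move=> [[K K0 gK] uv1 gD]; split.
  move=> e e0; have K1 : 0 < K + 1 by lra.
  exists (e / (K + 1)); first exact: divr_gt0.
  move=> n x y xy _; rewrite ltr_pdivlMr// mulr_suml; apply: le_lt_trans.
  apply: ler_sum => i _; have [ax [xy' yb]] := xy i.
  apply: le_trans (gK _ _ _ _) _; try by apply/andP; split; lra.
  rewrite ger0_norm ?subr_ge0// mulrC ler_wpM2l ?subr_ge0// lerDl//.
(* The derivative is given only inside the interval, so the endpoints join the exceptional
   points. *)
have cl : countable [set x | x \in [:: a, b & l]].
  exact/finite_set_countable/finite_seq.
exists [set x | x \in [:: a, b & l]]; split.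
- exact: countable_measurable.
- exact: countable_lebesgue_measure0.
move=> s /= H; apply: contrapT => sl; apply: H => sab.
move: sl; rewrite !inE => /negP; rewrite !negb_or => /and3P[sa sb sl].
apply: gD => //; move: sab; rewrite in_itv /= => /andP[as_ sb_].
by rewrite !lt_neqAle as_ sb_ eq_sym sa sb.
Qed.

Lemma unit_curve_d_cc a b g u v l : a <= b -> unit_curve a b g u v l ->
  (d_cc (g a) (g b) <= (b - a)%:E)%E.
Proof.
move=> ab guv; apply: ereal_inf_lbound.
exists a, b, g, u, v; split => //; first exact: unit_curve_horizontal guv.
case: guv => _ uv1 _; rewrite /cc_length.
under eq_integral do rewrite uv1 sqrtr1.
rewrite integral_cst; last exact: measurable_itv.
by rewrite mul1e; apply: esym; exact: lebesgue_measure_bounded_itv.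
Qed.

(** For [s' < s], reversing time gives a curve from [g s] to [g s']; this stands in for the symmetry
    of [d_cc]. *)
Lemma unit_curve_d_cc_dist a b g u v l s s' : unit_curve a b g u v l ->
  a <= s <= b -> a <= s' <= b -> (d_cc (g s) (g s') <= `|s' - s|%:E)%E.
Proof.
move=> guv /andP[as_ sb] /andP[as' s'b]; have [ss'|/ltW s's] := leP s s'.
  rewrite ger0_norm ?subr_ge0//.
  exact: unit_curve_d_cc (unit_curve_sub as_ s'b guv).
have guv' : unit_curve (- s) (- s') (fun t => g (0 + -1 * t))
    (fun t => -1 * u (0 + -1 * t)) (fun t => -1 * v (0 + -1 * t))
    [seq -1 * (x - 0) | x <- l].
  apply: unit_curve_reparam (unit_curve_sub as' sb guv).
  - by rewrite normrN1.
  - by move=> t /andP[? ?]; apply/andP; split; lra.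
  - by move=> t /andP[? ?]; apply/andP; split; lra.
have := unit_curve_d_cc _ guv'; rewrite lerN2 => /(_ s's).
by rewrite !add0r !mulN1r !opprK ler0_norm ?subr_le0// opprB addrC.
Qed.

End UnitCurves.

(** * Paths of given length inside a set *)

Section Paths.
Context {R : realType}.
Implicit Types (p q w : R * R * R) (Z : set (R * R * R)).

(** By unit speed, the duration [L] is also the cc-length. *)
Definition hpath Z p q (L : R) : Prop :=
  exists (a b : R) (g : R -> R * R * R) (u v : R -> R) (l : seq R),
    [/\ a <= b, b - a = L, g a = p & g b = q] /\
    (unit_curve a b g u v l /\ forall s, a <= s <= b -> Z (g s)).

Lemma hpath_sym Z p q L : hpath Z p q L -> hpath Z q p L.
Proof.
move=> [a [b [g [u [v [l [[ab bL gp gq] [guv gZ]]]]]]]].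
exists (- b), (- a), (fun t => g (0 + -1 * t)).
exists (fun t => -1 * u (0 + -1 * t)), (fun t => -1 * v (0 + -1 * t)).
exists [seq -1 * (x - 0) | x <- l]; split; [|split].
- by rewrite !add0r !mulN1r !opprK lerN2; split => //; rewrite addrC.
- apply: unit_curve_reparam guv.
  + by rewrite normrN1.
  + by move=> t /andP[? ?]; apply/andP; split; lra.
  + by move=> t /andP[? ?]; apply/andP; split; lra.
- by move=> s /andP[? ?]; apply: gZ; apply/andP; split; lra.
Qed.

Lemma hpath_trans Z p q r L M : hpath Z p q L -> hpath Z q r M ->
  hpath Z p r (L + M).
Proof.
move=> [a [b [g [u [v [l [[ab bL gp gq] [guv gZ]]]]]]]].
move=> [a' [b' [g' [u' [v' [l' [[ab' bL' gp' gq'] [guv' gZ']]]]]]]].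
pose k := a' - b.
have guv'' : unit_curve b (b + M) (fun t => g' (k + 1 * t))
    (fun t => 1 * u' (k + 1 * t)) (fun t => 1 * v' (k + 1 * t))
    [seq 1 * (x - k) | x <- l'].
  apply: unit_curve_reparam guv'.
  - by rewrite normr1.
  - by move=> t /andP[? ?]; rewrite /k; apply/andP; split; lra.
  - by move=> t /andP[? ?]; rewrite /k; apply/andP; split; lra.
have bc : b <= b + M by lra.
have g12 : g b = g' (k + 1 * b) by rewrite gq -gp'; congr g'; rewrite /k; ring.
do 6 eexists; split; last first.
  split; first exact: unit_curve_cat ab bc g12 guv guv''.
  move=> s /andP[as_ sb] /=; case: leP => bs.
    by apply: gZ; rewrite as_.
  by apply: gZ'; rewrite /k; apply/andP; split; lra.
split => //=; [lra|lra|by rewrite ab|].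
(* At time [b + M] the test [s <= b] selects the first curve only if [M = 0], and then the second
   curve is a single point. *)
case: leP => bM; last by rewrite -gq'; congr g'; rewrite /k; lra.
have M0 : M = 0 by lra.
rewrite M0 addr0 g12 -gq'; congr g'; rewrite /k; lra.
Qed.

(** By the hypothesis on [w], the constant controls [u] and [v] produce the direction [w] all along
    the line, so a Euclidean segment is an integral curve. *)
Lemma hpath_line Z p w (u v r : R) : u ^+ 2 + v ^+ 2 = 1 ->
  (forall s, u *: heisX (p + s *: w) + v *: heisY (p + s *: w) = w) ->
  (forall s, `|s| <= `|r| -> Z (p + s *: w)) ->
  hpath Z p (p + r *: w) `|r|.
Proof.
(* The sign of [r] goes into the controls, so that time runs from 0 to [|r|]. *)
move=> uv1 wE pZ; pose sg : R := (-1) ^+ (r < 0)%R.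
exists 0, `|r|, (fun s => p + (s * sg) *: w), (fun=> sg * u), (fun=> sg * v).
exists [::].
split; first by rewrite subr0 mul0r scale0r addr0 mulrC -numEsign.
have subE s s' : p + (s' * sg) *: w - (p + (s * sg) *: w) =
    (s' - s) *: (sg *: w).
  by rewrite opprD addrACA subrr add0r -scalerBl -mulrBl scalerA.
split; last first.
  by move=> s /andP[s0 sr]; apply: pZ; rewrite mulrC normrMsign ger0_norm.
split => //.
- by exists `|sg *: w| => // s s' _ _; rewrite subE normrZ mulrC.
- by move=> _; rewrite !exprMn -mulrDr uv1 sqrr_sign mul1r.
move=> s _ _.
have -> : (sg * u) *: heisX (p + (s * sg) *: w) +
    (sg * v) *: heisY (p + (s * sg) *: w) = sg *: w.
  by rewrite -[in RHS](wE (s * sg)) scalerDr !scalerA.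
apply/is_derive_distP => e e0.
exists 1 => // x _; rewrite subE subrr normr0 mulr_ge0//; exact: ltW.
Qed.

(** Right translation by [(s, 0, 0)] is the flow of [heisX]; it fixes [y], so the field is constant
    along each orbit. *)
Lemma heis_mulX p (s : R) : heis_mul p (s, 0, 0) = p + s *: heisX p.
Proof.
case: p => [[x y] t] /=.
rewrite (_ : _ + _ = (x + s * 1, y + s * 0, t + s * (2 * y)))//.
by congr (_, _, _); ring.
Qed.

Lemma heis_mulY p (s : R) : heis_mul p (0, s, 0) = p + s *: heisY p.
Proof.
case: p => [[x y] t] /=.
rewrite (_ : _ + _ = (x + s * 0, y + s * 1, t + s * - (2 * x)))//.
by congr (_, _, _); ring.
Qed.

Lemma hpath_X Z p (r : R) :
  (forall s, `|s| <= `|r| -> Z (heis_mul p (s, 0, 0))) ->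
  hpath Z p (heis_mul p (r, 0, 0)) `|r|.
Proof.
move=> pZ; rewrite heis_mulX; apply: (@hpath_line _ _ _ 1 0).
- by rewrite expr1n expr0n addr0.
- move=> s; rewrite scale1r scale0r addr0 -heis_mulX.
  by case: p {pZ} => [[x y] t]; rewrite /heisX /= addr0.
- by move=> s /pZ; rewrite heis_mulX.
Qed.

Lemma hpath_Y Z p (r : R) :
  (forall s, `|s| <= `|r| -> Z (heis_mul p (0, s, 0))) ->
  hpath Z p (heis_mul p (0, r, 0)) `|r|.
Proof.
move=> pZ; rewrite heis_mulY; apply: (@hpath_line _ _ _ 0 1).
- by rewrite expr1n expr0n add0r.
- move=> s; rewrite scale1r scale0r add0r -heis_mulY.
  by case: p {pZ} => [[x y] t]; rewrite /heisY /= addr0.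
- by move=> s /pZ; rewrite heis_mulY.
Qed.

(** Each term is at most the elapsed time, and these times telescope. The left end [c] varies so
    that the induction can drop the first partition point. *)
Lemma unit_curve_length_le (a b : R) g u v l (p : seq R) (c : R) :
  unit_curve a b g u v l -> a <= c -> itv_partition c b p ->
  (\sum_(0 <= i < size p)
    d_cc (g (nth b (c :: p) i)) (g (nth b (c :: p) i.+1)) <= (b - c)%:E)%E.
Proof.
move=> guv; elim: p c => [|x p IH] c ac cb.
  by rewrite big_nil lee_fin subr_ge0 (itv_partition_le cb).
have := itv_partition_cons cb; have := itv_partition_le cb => cb' xb.
have xb' := itv_partition_le xb.
have cx : c < x by case: cb => /= /andP[].
rewrite big_nat_recl//= (_ : b - c = `|x - c| + (b - x)); last first.
  by rewrite ger0_norm ?subr_ge0 ?ltW//; ring.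
rewrite EFinD; apply: leeD.
  by apply: unit_curve_d_cc_dist guv _ _; apply/andP; split; lra.
by apply: IH => //; lra.
Qed.

Lemma hpath_quasiconvex Z p q (L : R) : hpath Z p q L ->
  exists (a b : R) (g : R -> R * R * R),
    [/\ a <= b, g a = p & g b = q] /\
    [/\ forall s, a <= s <= b -> Z (g s),
        metric_curve (@d_cc R) a b g &
        (metric_length (@d_cc R) a b g <= L%:E)%E].
Proof.
move=> [a [b [g [u [v [l [[ab bL gp gq] [guv gZ]]]]]]]].
exists a, b, g; split => //; split => //.
- move=> s sab e e0; exists e => // s' s'ab ss'.
  by apply: le_lt_trans (unit_curve_d_cc_dist guv sab s'ab) _; rewrite lte_fin.
- apply: ge_ereal_sup => _ [s sab <-]; rewrite -bL.
  exact: unit_curve_length_le guv _ sab.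
Qed.

End Paths.

(** * Four-letter words and generic points *)

Section Words.
Context {R : realType}.
Implicit Types (p q h : R * R * R) (Z : set (R * R * R)).

Lemma heis_mulE p q : heis_mul p q = (p.1.1 + q.1.1, p.1.2 + q.1.2,
  p.2 + q.2 + 2 * (q.1.1 * p.1.2 - p.1.1 * q.1.2)).
Proof. by case: p q => [[x y] t] [[x' y'] t']. Qed.

Lemma heis_mul0 p : heis_mul p (0, 0, 0) = p.
Proof.
by case: p => [[x y] t]; rewrite heis_mulE /=; congr (_, _, _); ring.
Qed.

Lemma heis_mulK h p : heis_mul (heis_mul p h) (- h) = p.
Proof.
case: p h => [[x y] t] [[x' y'] t'].
by rewrite !heis_mulE /=; congr (_, _, _); ring.
Qed.

Definition heis_word p (a b c d : R) : R * R * R :=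
  heis_mul (heis_mul (heis_mul (heis_mul p (a, 0, 0)) (0, b, 0)) (c, 0, 0))
    (0, d, 0).

Lemma heis_wordE p (a b c d : R) : heis_word p a b c d =
  (p.1.1 + a + c, p.1.2 + b + d, p.2 + 2 * a * p.1.2 - 2 * (p.1.1 + a) * b +
     2 * c * (p.1.2 + b) - 2 * (p.1.1 + a + c) * d).
Proof. by rewrite /heis_word !heis_mulE /=; congr (_, _, _); ring. Qed.

(** This solves [t = 4 b c - 2 x y] for [b c], with [(x, y, t)] the coordinates of [p^-1 * q]. *)
Definition heis_area p q : R :=
  (heis_t p q + 2 * (q.1.1 - p.1.1) * (q.1.2 - p.1.2)) / 4.

(** When [|b|] and [|c|] both equal the square root of [|heis_area p q|], the letters [a] and [d]
    differ from the displacements by that root, whence the factor 4. *)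
Definition heis_cost p q : R := `|q.1.1 - p.1.1| + `|q.1.2 - p.1.2| +
  4 * Num.sqrt `|heis_area p q|.

(* The word X^a Y^b X^c Y^d reaches the horizontal displacement (x, y) when
   a + c = x and b + d = y; its t-coordinate is then 4 b c - 2 x y, so that
   [b * c = heis_area p q] adjusts the last coordinate. *)
Lemma heis_word_exists p q : exists a b c d,
  q = heis_word p a b c d /\ `|a| + `|b| + `|c| + `|d| <= heis_cost p q.
Proof.
pose w := heis_area p q; pose r := Num.sqrt `|w|.
have r0 : 0 <= r by exact: sqrtr_ge0.
have sgr : `|Num.sg w * r| <= r.
  rewrite normrM normr_sg (ger0_norm r0).
  by case: (w != 0); rewrite ?mul1r ?mul0r.
have wE : r * (Num.sg w * r) = w.
  by rewrite mulrCA -expr2 sqr_sqrtr// [RHS]numEsg.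
exists (q.1.1 - p.1.1 - Num.sg w * r), r, (Num.sg w * r), (q.1.2 - p.1.2 - r).
split.
  rewrite heis_wordE; move: wE; rewrite {2}/w /heis_area /heis_t.
  clear r0 sgr; move: (Num.sg w) r => e r; clear w.
  case: p q => [[x y] t] [[x' y'] t'] /= wE.
  congr (_, _, _); [ring|ring|].
  have -> : t' = 4 * (r * (e * r)) - 2 * (x' - x) * (y' - y) + t -
    2 * (x * y' - x' * y) by rewrite wE; field.
  ring.
rewrite /heis_cost -/w -/r (ger0_norm r0).
have := ler_normB (q.1.1 - p.1.1) (Num.sg w * r).
have := ler_normB (q.1.2 - p.1.2) r; rewrite (ger0_norm r0).
by lra.
Qed.

Lemma heis_cost_eq0 p q : heis_cost p q <= 0 -> p = q.
Proof.
move=> pq; have [a [b [c [d [qE abcd]]]]] := heis_word_exists p q.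
have [a0 b0 c0 d0] : [/\ a = 0, b = 0, c = 0 & d = 0].
  have := normr_ge0 a; have := normr_ge0 b; have := normr_ge0 c.
  have := normr_ge0 d.
  by split; apply/eqP; rewrite -normr_eq0; apply/eqP; lra.
by rewrite qE a0 b0 c0 d0 /heis_word !heis_mul0.
Qed.

(** A curve shorter than [r'] gives [|heis_area p q| <= (4 + 2) / 4 * r' ^ 2], with root at most
    [5 / 4 * r'], so the cost is at most [(1 + 1 + 5) * r']. *)
Lemma heis_cost_le_d_cc p q : ((heis_cost p q / 7)%:E <= d_cc p q)%E.
Proof.
apply: le_ereal_inf_tmp => L [a [b [g [u [v [ab gp gq guv ->]]]]]].
rewrite leNgt; apply/negP => Lpq.
have L0 : (0 <= cc_length a b u v)%E.
  by apply: integral_ge0 => s _; rewrite lee_fin sqrtr_ge0.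
have [r rE] : exists r, cc_length a b u v = r%:E.
  exists (fine (cc_length a b u v)); rewrite fineK// ge0_fin_numE//.
  exact: lt_le_trans Lpq (leey _).
rewrite rE lee_fin in L0; rewrite rE lte_fin in Lpq.
(* The coordinate bounds need a number strictly above the length; the midpoint also stays below
   [heis_cost p q / 7]. *)
pose r' := (r + heis_cost p q / 7) / 2.
have rr' : r < r' by rewrite /r'; lra.
have := horizontal_coord_le ab guv (r := r'); rewrite rE lte_fin gp gq.
move=> /(_ rr')[hx hy ht].
suff : heis_cost p q <= 7 * r' by rewrite /r'; lra.
have r'0 : 0 < r' by lra.
suff : Num.sqrt `|heis_area p q| <= 5 / 4 * r' by rewrite /heis_cost; lra.
rewrite -[leRHS]ger0_norm -?[leRHS]sqrtr_sqr; last by lra.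
apply: ler_wsqrtr.
rewrite /heis_area normrM (gtr0_norm (_ : 0 < 4^-1)) ?invr_gt0//.
have := ler_normD (heis_t p q) (2 * (q.1.1 - p.1.1) * (q.1.2 - p.1.2)).
rewrite !normrM (gtr0_norm (ltr0Sn _ 1)).
have := ler_pM (normr_ge0 _) (normr_ge0 _) hx hy.
by rewrite !expr2 in ht *; nra.
Qed.

(** A point of the broken path is a word with one letter shortened and all later letters zero, so it
    belongs to the box of words in the hypothesis. *)
Lemma hpath_word Z p (a b c d : R) :
  (forall a' b' c' d', `|a'| <= `|a| -> `|b'| <= `|b| -> `|c'| <= `|c| ->
    `|d'| <= `|d| -> Z (heis_word p a' b' c' d')) ->
  hpath Z p (heis_word p a b c d) (`|a| + `|b| + `|c| + `|d|).
Proof.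
move=> pZ.
apply: hpath_trans; last first.
  apply: hpath_Y => s sd; exact: pZ.
apply: hpath_trans; last first.
  apply: hpath_X => s sc; have := pZ a b s 0; rewrite /heis_word heis_mul0.
  by rewrite normr0; apply.
apply: hpath_trans; last first.
  apply: hpath_Y => s sb; have := pZ a s 0 0; rewrite /heis_word !heis_mul0.
  by rewrite normr0; apply.
apply: hpath_X => s sa; have := pZ s 0 0 0; rewrite /heis_word !heis_mul0.
by rewrite normr0; apply.
Qed.

End Words.

(** * Continuity of the group operations and dense open sets *)

Section Topology.
Context {R : realType}.
Implicit Types (p q h : R * R * R) (Z : set (R * R * R)).

Lemma cvg_triple (T : Type) (F : set_system T) {FF : Filter F}
    (x y t : T -> R) (x0 y0 t0 : R) :
  x @ F --> x0 -> y @ F --> y0 -> t @ F --> t0 ->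
  (x s, y s, t s) @[s --> F] --> (x0, y0, t0).
Proof.
move=> hx hy ht.
have hxy : (x s, y s) @[s --> F] --> (x0, y0) by exact: (cvg_pair hx hy).
apply: (@cvg_pair _ _ _ F (nbhs (x0, y0)) (nbhs t0)) => //.
Qed.

Lemma cvg_coord (T : Type) (F : set_system T) {FF : Filter F}
    (f : T -> R * R * R) p : f @ F --> p ->
  [/\ (f s).1.1 @[s --> F] --> p.1.1, (f s).1.2 @[s --> F] --> p.1.2 &
      (f s).2 @[s --> F] --> p.2].
Proof.
move=> fp; have fp1 : (f s).1 @[s --> F] --> p.1.
  by apply: cvg_comp fp _; exact: cvg_fst.
split.
- by apply: cvg_comp fp1 _; exact: cvg_fst.
- by apply: cvg_comp fp1 _; exact: cvg_snd.
- by apply: cvg_comp fp _; exact: cvg_snd.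
Qed.

Lemma cvg_heis_mul (T : Type) (F : set_system T) {FF : Filter F}
    (f g : T -> R * R * R) p q : f @ F --> p -> g @ F --> q ->
  heis_mul (f s) (g s) @[s --> F] --> heis_mul p q.
Proof.
move=> /cvg_coord[fx fy ft] /cvg_coord[gx gy gt]; rewrite heis_mulE.
under eq_fun do rewrite heis_mulE.
apply: cvg_triple; [exact: cvgD|exact: cvgD|].
apply: cvgD; first exact: cvgD.
by apply: cvgM; [exact: cvg_cst|apply: cvgB; exact: cvgM].
Qed.

Lemma cvg_heis_word (T : Type) (F : set_system T) {FF : Filter F}
    (f : T -> R * R * R) (a b c d : T -> R) p (a0 b0 c0 d0 : R) :
  f @ F --> p -> a @ F --> a0 -> b @ F --> b0 -> c @ F --> c0 ->
  d @ F --> d0 ->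
  heis_word (f s) (a s) (b s) (c s) (d s) @[s --> F] -->
    heis_word p a0 b0 c0 d0.
Proof.
move=> fp aF bF cF dF; rewrite /heis_word.
apply: cvg_heis_mul; last by apply: cvg_triple => //; exact: cvg_cst.
apply: cvg_heis_mul; last by apply: cvg_triple => //; exact: cvg_cst.
apply: cvg_heis_mul; last by apply: cvg_triple => //; exact: cvg_cst.
by apply: cvg_heis_mul => //; apply: cvg_triple => //; exact: cvg_cst.
Qed.

Lemma cvg_heis_cost p : heis_cost p q @[q --> p] --> (0 : R).
Proof.
have [hx hy ht] := @cvg_coord _ (nbhs p) _ id p (@cvg_id _ (nbhs p)).
have cst (k : R) : (fun=> k) @ nbhs p --> k by exact: cvg_cst.
rewrite (_ : 0 = heis_cost p p); last first.
  rewrite /heis_cost /heis_area /heis_t.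
  by rewrite !(subrr, mulr0, mul0r, addr0, normr0, sqrtr0).
apply: cvgD.
  by apply: cvgD; apply: cvg_norm; exact: cvgB.
apply: cvgM => //.
apply: continuous_cvg; first exact: sqrt_continuous.
apply: cvg_norm; apply: cvgM => //; apply: cvgD.
  apply: cvgD; first exact: cvgB.
  by apply: cvgM => //; apply: cvgB; apply: cvgM.
by apply: cvgM; [apply: cvgM => //|]; exact: cvgB.
Qed.

(** The letters of the word from [p] to [q] are bounded by the cost, which tends to 0 as [q] tends
    to [p]; short words from [p] stay in [Z] by continuity at the trivial word. *)
Lemma near_hpath Z p (eta : R) : open Z -> Z p -> 0 < eta ->
  \forall q \near p, exists2 L, L <= eta & hpath Z p q L.
Proof.
move=> oZ Zp eta0.
pose f (z : R * R * R * R) := heis_word p z.1.1.1 z.1.1.2 z.1.2 z.2.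
pose z0 : R * R * R * R := (0, 0, 0, 0).
have fz0 : f z @[z --> z0] --> p.
  rewrite -[X in _ --> X](_ : f z0 = p); last first.
    by rewrite /f /heis_word !heis_mul0.
  have h1 : z.1 @[z --> z0] --> z0.1 by exact: cvg_fst.
  have [h2 h3 h4] := cvg_coord h1.
  by apply: cvg_heis_word => //; [exact: cvg_cst|exact: cvg_snd].
have : nbhs z0 (f @^-1` Z) by apply: fz0; exact: open_nbhs_nbhs.
move=> /nbhs_ballP[delta /= delta0 Hdelta].
near=> q.
have qd : heis_cost p q < Num.min delta eta.
  near: q; apply: (cvgr_lt (0 : R)); first exact: cvg_heis_cost.
  by rewrite lt_min delta0.
move: qd; rewrite lt_min => /andP[qdelta qeta].
have [a [b [c [d [qE abcd]]]]] := heis_word_exists p q.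
exists (`|a| + `|b| + `|c| + `|d|); first exact: le_trans abcd (ltW qeta).
rewrite [in X in hpath _ _ X]qE; apply: hpath_word => a' b' c' d' ha hb hc hd.
apply: (Hdelta (a', b', c', d')).
have := normr_ge0 a; have := normr_ge0 b; have := normr_ge0 c.
have := normr_ge0 d => d0 c0 b0 a0.
by split; [split; [split|]|]; rewrite /= /ball /= sub0r normrN; lra.
Unshelve. all: by end_near. Qed.

Lemma dense_translate (U : set (R * R * R)) h : open U -> dense U ->
  open [set p | U (heis_mul p h)] /\ dense [set p | U (heis_mul p h)].
Proof.
move=> oU dU.
have cont k : continuous (fun p => heis_mul p k).
  by move=> p; apply: cvg_heis_mul; [exact: cvg_id|exact: cvg_cst].
split; first exact: (open_comp (fun p _ => cont h p) oU).
move=> V [p Vp] oV.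
have [] := dU [set q | V (heis_mul q (- h))].
- by exists (heis_mul p h); rewrite /= heis_mulK.
- exact: (open_comp (fun p _ => cont (- h) p) oV).
move=> q [/= Vq Uq]; exists (heis_mul q (- h)); split => //=.
by have := heis_mulK (- h) q; rewrite opprK => ->.
Qed.

(** A continuous section through each point makes [f] an open map. An open [V] around [x] that
    missed the set would make [f x] interior to [closure S]. *)
Lemma nowhere_dense_preimage (T U : topologicalType) (S : set U) (f : T -> U) :
  nowhere_dense S -> continuous f ->
  (forall x, exists2 g : U -> T, g (f x) = x /\ {for f x, continuous g} &
    forall y, f (g y) = y) ->
  open [set x | ~ closure S (f x)] /\ dense [set x | ~ closure S (f x)].
Proof.
move=> Snd fc fsec; split.
  apply: (open_comp (fun x _ => fc x) (_ : open (~` closure S))).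
  exact/closed_openC/closed_closure.
move=> V [x Vx] oV; apply: contrapT => V0.
have [g [gx gc] fg] := fsec x.
have : interior (closure S) (f x).
  have : nbhs (f x) (g @^-1` V).
    by apply: gc; rewrite gx; exact: open_nbhs_nbhs.
  apply: filterS => y /= Vy; apply: contrapT => Sy.
  by apply: V0; exists (g y); split => //=; rewrite fg.
by rewrite Snd.
Qed.

End Topology.

(** * Broken paths in the complement of [A] *)

Section Main.
Context {R : realType}.
Implicit Types (A : set (R * R * R)) (p : R * R * R).

(** Dropping the vanishing middle coordinate of [pi_y] gives a map into the plane in which nowhere
    density is stated. *)
Definition xt_coord p : R * R := ((pi_y p).1.1, (pi_y p).2).
Definition yt_coord p : R * R := ((pi_x p).1.2, (pi_x p).2).

Lemma continuous_xt_coord : continuous xt_coord.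
Proof.
move=> p.
have [hx hy ht] := @cvg_coord _ _ (nbhs p) _ id p (@cvg_id _ (nbhs p)).
have [kx ky kt] := cvg_coord (cvg_heis_mul (@cvg_id _ (nbhs p) : id @ p --> p)
  (cvg_triple (cvg_cst (0 : R)) (cvgN hy) (cvg_cst (0 : R)))).
exact: (@cvg_pair _ _ _ (nbhs p) (nbhs _) (nbhs _)).
Qed.

Lemma continuous_yt_coord : continuous yt_coord.
Proof.
move=> p.
have [hx hy ht] := @cvg_coord _ _ (nbhs p) _ id p (@cvg_id _ (nbhs p)).
have [kx ky kt] := cvg_coord (cvg_heis_mul (@cvg_id _ (nbhs p) : id @ p --> p)
  (cvg_triple (cvgN hx) (cvg_cst (0 : R)) (cvg_cst (0 : R)))).
exact: (@cvg_pair _ _ _ (nbhs p) (nbhs _) (nbhs _)).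
Qed.

Lemma xt_generic A : nowhere_dense (@xt_plane R @^-1` (pi_y @` A)) ->
  exists2 U : set (R * R * R), open U /\ dense U &
    forall p s, U p -> ~ A (heis_mul p (0, s, 0)).
Proof.
move=> And.
exists [set p | ~ closure (@xt_plane R @^-1` (pi_y @` A)) (xt_coord p)].
  apply: nowhere_dense_preimage And _ _; first exact: continuous_xt_coord.
  (* The section through [p] moves each point of the plane along its fibre to the [y]-coordinate of
     [p]. *)
  move=> p; exists (fun z => heis_mul (xt_plane z) (0, p.1.2, 0)); last first.
    by case=> x t; rewrite /xt_coord pi_yE /=; congr (_, _); ring.
  split; first by case: p => [[x y] t]; rewrite /xt_coord pi_yE /=;
    congr (_, _, _); ring.
  apply: cvg_heis_mul; last exact: cvg_cst.
  by apply: cvg_triple; [exact: cvg_fst|exact: cvg_cst|exact: cvg_snd].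
move=> p s /= Sp Aps; apply: Sp; apply: subset_closure => /=.
exists (heis_mul p (0, s, 0)) => //.
case: p {Aps} => [[x y] t]; rewrite /xt_plane /xt_coord /heis_mul !pi_yE /=.
by congr (_, _, _); ring.
Qed.

Lemma yt_generic A : nowhere_dense (@yt_plane R @^-1` (pi_x @` A)) ->
  exists2 U : set (R * R * R), open U /\ dense U &
    forall p s, U p -> ~ A (heis_mul p (s, 0, 0)).
Proof.
move=> And.
exists [set p | ~ closure (@yt_plane R @^-1` (pi_x @` A)) (yt_coord p)].
  apply: nowhere_dense_preimage And _ _; first exact: continuous_yt_coord.
  move=> p; exists (fun z => heis_mul (yt_plane z) (p.1.1, 0, 0)); last first.
    by case=> y t; rewrite /yt_coord pi_xE /=; congr (_, _); ring.
  split; first by case: p => [[x y] t]; rewrite /yt_coord pi_xE /=;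
    congr (_, _, _); ring.
  apply: cvg_heis_mul; last exact: cvg_cst.
  by apply: cvg_triple; [exact: cvg_cst|exact: cvg_fst|exact: cvg_snd].
move=> p s /= Sp Aps; apply: Sp; apply: subset_closure => /=.
exists (heis_mul p (s, 0, 0)) => //.
case: p {Aps} => [[x y] t]; rewrite /yt_plane /yt_coord /heis_mul !pi_xE /=.
by congr (_, _, _); ring.
Qed.

(** The letters stay those of the word from [p] to [q]; only the base point moves, to a generic [p']
    so close to [p] that the new end is also close to [q]. *)
Lemma hpath_avoiding A p q (eta : R) : closed A ->
  nowhere_dense (@xt_plane R @^-1` (pi_y @` A)) ->
  nowhere_dense (@yt_plane R @^-1` (pi_x @` A)) ->
  ~ A p -> ~ A q -> 0 < eta ->
  exists2 L, L <= heis_cost p q + eta & hpath (~` A) p q L.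
Proof.
move=> cA /xt_generic[Uy [oUy dUy] Uy_line] /yt_generic[Ux [oUx dUx] Ux_line].
move=> nAp nAq eta0; have oA : open (~` A) by exact: closed_openC.
have [a [b [c [d [qE abcd]]]]] := heis_word_exists p q.
have eta2 : 0 < eta / 2 by lra.
pose pa p' := heis_mul p' (a, 0, 0).
pose pb p' := heis_mul (pa p') (0, b, 0).
pose pc p' := heis_mul (pb p') (c, 0, 0).
(* Each corner of the broken path is a right translate of [p']. A corner that starts an [X] line
   must lie in [Ux], one that starts a [Y] line in [Uy]. *)
have [oa da] := dense_translate (a, 0, 0) oUy dUy.
have [ob' db'] := dense_translate (0, b, 0) oUx dUx.
have [ob db] := dense_translate (a, 0, 0) ob' db'.
have [oc'' dc''] := dense_translate (c, 0, 0) oUy dUy.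
have [oc' dc'] := dense_translate (0, b, 0) oc'' dc''.
have [oc dc] := dense_translate (a, 0, 0) oc' dc'.
have near_q : \forall p' \near p, exists2 L, L <= eta / 2 &
    hpath (~` A) q (heis_word p' a b c d) L.
  have : heis_word p' a b c d @[p' --> p] --> q.
    rewrite [X in _ --> X]qE.
    have cst (k : R) : (fun=> k) @ nbhs p --> k by exact: cvg_cst.
    exact: (cvg_heis_word (@cvg_id _ (nbhs p)) (cst a) (cst b) (cst c) (cst d)).
  exact: (fun H => H _ (near_hpath oA nAq eta2)).
have : \forall p' \near p, (exists2 L, L <= eta / 2 & hpath (~` A) p p' L) /\
    exists2 L, L <= eta / 2 & hpath (~` A) q (heis_word p' a b c d) L.
  exact: filterI (near_hpath oA nAp eta2) near_q.
move=> /nbhs_interior; set N := _° => /nbhs_singleton Np.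
have dU := denseI oUx dUx (denseI oa da (denseI ob db dc)).
have [p' [/interior_subset[]]] := dU N (ex_intro _ p Np) (@open_interior _ _).
move=> [L1 L1eta path1] [L2 L2eta path2] [Up' [Ua [Ub Uc]]].
exists (L1 + (`|a| + `|b| + `|c| + `|d|) + L2); first lra.
apply: hpath_trans (hpath_sym path2); apply: hpath_trans path1 _.
apply: hpath_trans; last by apply: hpath_Y => s _; exact: Uy_line.
apply: hpath_trans; last by apply: hpath_X => s _; exact: Ux_line.
apply: hpath_trans; last by apply: hpath_Y => s _; exact: Uy_line.
by apply: hpath_X => s _; exact: Ux_line.
Qed.

End Main.

Theorem theorem1p1 (R : realType) (A : set (R * R * R)) :
  closed A ->
  nowhere_dense (@xt_plane R @^-1` (pi_y @` A)) ->
  nowhere_dense (@yt_plane R @^-1` (pi_x @` A)) ->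
  quasiconvex (~` A) (@d_cc R).
Proof.
(* With slack [heis_cost p q / 7] the path has length at most [8 / 7] of the cost, and the cost is
   at most 7 times the distance. *)
move=> cA Ay Ax; exists 8 => [|p q nAp nAq]; first by rewrite ler1n.
have [L [Lcost pqL]] : exists L,
    L <= 8 / 7 * heis_cost p q /\ hpath (~` A) p q L.
  (* Zero cost leaves no positive slack, but then the points coincide and a constant path serves. *)
  have [/heis_cost_eq0 <-|cost0] := leP (heis_cost p q) 0.
    exists 0; split.
      by rewrite mulr_ge0// /heis_cost !addr_ge0// mulr_ge0// sqrtr_ge0.
    have := @hpath_X R (~` A) p 0; rewrite heis_mul0 normr0; apply => s s0.
    by have -> : s = 0; [apply/eqP; rewrite -normr_le0|rewrite heis_mul0].
  have eta0 : 0 < heis_cost p q / 7 by lra.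
  have [L Lcost pqL] := hpath_avoiding cA Ay Ax nAp nAq eta0.
  by exists L; split => //; lra.
have [a [b [g [ends [gA gcont gL]]]]] := hpath_quasiconvex pqL.
exists a, b, g; split => //; split => //; first exact: le_lt_trans gL (ltry _).
apply: le_trans gL _.
have := @lee_wpmul2l _ 8%:E _ _ _ (heis_cost_le_d_cc p q).
rewrite lee_fin ler0n => /(_ isT); apply: le_trans.
by rewrite -EFinM lee_fin; lra.
Qed.
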